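(* Let $f:\mathbb{R}^n\to\mathbb{R}$ be smooth, $\psi:\mathbb{R}^n\to\mathbb{R}$, $\phi=f+\psi$, and let $\mathbf{x}_1,\mathbf{x}_2,\ldots$ be the iterates generated by SpaRSA (defined in the context) for minimizing $\phi$. Suppose that: (A1) the level set $\mathcal{L}=\{\mathbf{x}\in\mathbb{R}^n:\phi(\mathbf{x})\le\phi(\mathbf{x}_1)\}$ is contained in the interior of a compact, convex set $\mathcal{K}$, and $f$ is Lipschitz continuously differentiable on $\mathcal{K}$; (A2) $\psi$ is convex and $\psi(\mathbf{x})$ is finite for all $\mathbf{x}\in\mathbb{R}^n$. Let $\mathbf{x}^*$ be a minimizer of $\phi$ over $\mathbb{R}^n$ and $\phi^*=\phi(\mathbf{x}^* )$. If, in addition, $f$ is convex, there is $\mu>0$ such that $$\phi(\mathbf{y})\ge\phi(\mathbf{x}^* )+\mu\|\mathbf{y}-\mathbf{x}^*\|^2\quad\text{for all }\mathbf{y}\in\mathbb{R}^n,$$ and $\phi_k^R=\phi_k^{\max}$ for every $k$, then there exist constants $\theta\in(0,1)$ and $c$ such that $$\phi(\mathbf{x}_k)-\phi^*\le c\,\theta^k\,(\phi(\mathbf{x}_1)-\phi^* )$$ for every $k$.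
   Context: ''Smooth'' means continuously differentiable. $\|\cdot\|$ is the Euclidean norm, and $\nabla f(\mathbf{x})$ is the gradient of $f$ written as a row vector. ''$f$ is Lipschitz continuously differentiable on $\mathcal{K}$'' means that $\nabla f$ is Lipschitz continuous on $\mathcal{K}$. Under (A1) and (A2), the minimum of $\phi$ over $\mathbb{R}^n$ is attained. SpaRSA algorithm. Given $\eta>1$, $\sigma\in(0,1)$, $[\alpha_{\min},\alpha_{\max}]\subset(0,\infty)$ and a starting guess $\mathbf{x}_1\in\mathbb{R}^n$, set $k=1$. Step 1: Choose $\alpha_0\in[\alpha_{\min},\alpha_{\max}]$ (the choice may differ from iteration to iteration). Step 2: Set $\alpha=\eta^j\alpha_0$, where $j\ge0$ is the smallest integer such that $\phi(\mathbf{x}_{k+1})\le\phi_k^R-\sigma\alpha\|\mathbf{x}_{k+1}-\mathbf{x}_k\|^2$, where $\mathbf{x}_{k+1}=\arg\min\{\nabla f(\mathbf{x}_k)\mathbf{z}+\alpha\|\mathbf{z}-\mathbf{x}_k\|^2+\psi(\mathbf{z}):\mathbf{z}\in\mathbb{R}^n\}$. Step 3: If $\mathbf{x}_{k+1}=\mathbf{x}_k$, terminate. Step 4: Set $k=k+1$ and go to Step 1. Here $\phi_k^R$ is a real number called the reference value at iteration $k$. For a fixed integer $M\ge1$, the GLL reference value is $\phi_k^{\max}=\max\{\phi(\mathbf{x}_{k-j}):0\le j<\min(k,M)\}$. ''For every $k$'' means for every iterate generated by the algorithm. *)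

(* Defs.v *)
From HB Require Import structures.
From mathcomp Require Import all_boot all_order all_algebra.
From mathcomp Require Import all_classical all_reals all_analysis.

Set Implicit Arguments.
Unset Strict Implicit.
Unset Printing Implicit Defensive.

Import Order.TTheory GRing.Theory Num.Theory.
Import numFieldNormedType.Exports.

Local Open Scope classical_set_scope.
Local Open Scope ring_scope.

(* The canonical norm `|A| on matrices is the sup norm, hence a separate
   Euclidean norm. Both induce the same topology, so that [interior],
   [compact], [continuous] and [differentiable] are the usual notions. *)
Definition enorm (R : realType) (m n : nat) (A : 'M[R]_(m, n)) : R :=
  Num.sqrt (\sum_i \sum_j A i j ^+ 2).

Definition gradient (R : realType) (n : nat) (f : 'cV[R]_n -> R)
    (x : 'cV[R]_n) : 'rV[R]_n :=
  \row_i 'D_(delta_mx i 0) f x.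

Definition smooth (R : realType) (n : nat) (f : 'cV[R]_n -> R) : Prop :=
  (forall x, differentiable f x) /\ continuous (gradient f).

Definition lipschitz_gradient_on (R : realType) (n : nat)
    (K : set 'cV[R]_n) (f : 'cV[R]_n -> R) : Prop :=
  exists L : R, forall x y, K x -> K y ->
    enorm (gradient f x - gradient f y) <= L * enorm (x - y).

Definition is_minimizer (R : realType) (n : nat) (g : 'cV[R]_n -> R)
    (x : 'cV[R]_n) : Prop :=
  forall y, g x <= g y.

Section SpaRSA.
Variables (R : realType) (n : nat).
Implicit Types (f psi phi : 'cV[R]_n -> R) (x : nat -> 'cV[R]_n).

Definition model f psi (alpha : R) (xk z : 'cV[R]_n) : R :=
  (gradient f xk *m z) 0 0 + alpha * enorm (z - xk) ^+ 2 + psi z.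

Definition accepted f psi (sigma ref alpha : R) (xk z : 'cV[R]_n) : Prop :=
  is_minimizer (model f psi alpha xk) z /\
  f z + psi z <= ref - sigma * alpha * enorm (z - xk) ^+ 2.

Definition sparsa_step f psi (eta sigma amin amax ref : R)
    (xk xk1 : 'cV[R]_n) : Prop :=
  exists (alpha0 : R) (j : nat),
    [/\ amin <= alpha0 <= amax,
        accepted f psi sigma ref (eta ^+ j * alpha0) xk xk1 &
        forall i z, (i < j)%N ->
          ~ accepted f psi sigma ref (eta ^+ i * alpha0) xk z].

(* Iterates are numbered from 1. The algorithm stops at the end of iteration i
   if x i.+1 = x i; a finite run is encoded by a sequence whose later values
   are arbitrary, and [executed] and [generated] delimit the meaningful part:
   iteration k takes place iff no earlier iteration stopped the algorithm, and
   for k > 1 the iterate x k is the outcome of iteration k.-1. *)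
Definition executed x (k : nat) : Prop :=
  forall i, (0 < i < k)%N -> x i.+1 <> x i.

Definition generated x (k : nat) : Prop := (0 < k)%N /\ executed x k.-1.

Definition sparsa f psi (eta sigma amin amax : R) (ref : nat -> R) x : Prop :=
  forall k, (0 < k)%N -> executed x k ->
    sparsa_step f psi eta sigma amin amax (ref k) (x k) (x k.+1).

(* The default value phi (x k) of the iterated maximum is its term j = 0, which
   is in the range whenever k and M are positive. *)
Definition gll_reference phi (M : nat) x (k : nat) : R :=
  \big[Num.max/phi (x k)]_(0 <= j < minn k M) phi (x (k - j)%N).

End SpaRSA.

(* Main.v *)
Require Import Defs.
From HB Require Import structures.
From mathcomp Require Import all_boot all_order all_algebra.
From mathcomp Require Import all_classical all_reals all_analysis.
From mathcomp Require Import ring lra zify.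
Set Implicit Arguments.
Unset Strict Implicit.
Unset Printing Implicit Defensive.

Import Order.TTheory GRing.Theory Num.Theory.
Import numFieldNormedType.Exports.
Local Open Scope classical_set_scope.
Local Open Scope ring_scope.

(** The proof has two halves: a bound on the accepted stepsizes, and a
    contraction that uses only that bound.

    Stepsizes. For f convex with L-Lipschitz gradient on K, the gradient
    inequality at y gives f y <= f x + grad f(x) (y - x) + L |y - x|^2 for x, y
    in K ([convex_descent]), so phi decreases by at least
    (alpha - L) |y - x|^2 as soon as y does not increase the model at x
    ([objective_le_model]). If alpha >= L, the segment from x to the minimizer z
    of the model cannot leave K: the model is convex, hence no point of the
    segment increases it, so every point of the segment that lies in K lies in
    the level set and therefore in the interior of K ([minimizer_in_compact]).
    Thus z satisfies the acceptance test whenever L <= (1 - sigma) alpha, and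
    the line search, which multiplies alpha by eta at each trial, stops at some
    alpha between amin and a constant abar ([accepted_stepsize_bounds]). This
    argument needs the model to have a minimizer for the rejected values of
    alpha as well: a finite convex function on a finite-dimensional space is
    continuous and decreases at most linearly, so adding alpha |z - x|^2 makes
    it coercive ([model_minimizer_exists]).

    Contraction. Write e = phi(x) - phi*, e' = phi(z) - phi*, V = ref - phi*
    and D = |z - x|^2 for one iteration from x to z. Comparing the model at z
    with its value at x + t (xstar - x), and using |x - xstar|^2 <= e / mu,
    gives e' <= (1 - t + alpha t^2 / mu) e + L D <= (1 - t/2) V + L D for a
    suitable fixed t. The acceptance test bounds D by a multiple of V - e', so
    e' <= kappa V with a fixed kappa < 1 ([accepted_contraction]). For the GLL
    reference value, V is one of the last M errors; hence each error is at most
    kappa times one of the M preceding ones, which is geometric decay with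
    ratio theta for any theta such that theta^M >= kappa
    ([windowed_contraction]). *)

(** * Convex functions *)

(** Real-parameter form of convexity, parametrized from the endpoint x, so that
    both sides measure the increase over g x. *)
Definition chord_convex {R : realType} {E : lmodType R} (g : E -> R) : Prop :=
  forall x y t, 0 <= t <= 1 -> g (x + t *: (y - x)) <= g x + t * (g y - g x).

Lemma convex_function_chord (R : realType) (E : lmodType R) (g : E -> R) :
  convex_function setT g -> chord_convex g.
Proof.
move=> cg x y t /andP[t0 t1].
have := cg (Itv01 t0 t1) y x (in_setT _) (in_setT _).
rewrite convRE /= /conv /= /unstable.onem.
have -> : t *: y + (1 - t) *: x = x + t *: (y - x).
  by rewrite scalerBl scale1r scalerBr addrCA addrA addrAC.
move=> /le_trans; apply; lra.
Qed.

Lemma chord_convexD (R : realType) (E : lmodType R) (g h : E -> R) :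
  chord_convex g -> chord_convex h -> chord_convex (fun z => g z + h z).
Proof. by move=> cg ch x y t t01; have := cg x y t t01; have := ch x y t t01; lra. Qed.

Lemma chord_convex_translate (R : realType) (E : lmodType R) (g : E -> R) (c : E) :
  chord_convex g -> chord_convex (fun h => g (c + h)).
Proof.
move=> cg x y t t01; have := cg (c + x) (c + y) t t01.
by rewrite opprD addrACA subrr add0r addrA.
Qed.

(** Jensen's inequality for a convex combination that puts the remaining weight
    on x itself. That weight is required to be positive, so that the induction
    can divide by it. *)
Lemma chord_convex_sum (R : realType) (E : lmodType R) (I : Type) (s : seq I)
    (g : E -> R) (x : E) (a : I -> R) (v : I -> E) :
  chord_convex g -> (forall i, 0 <= a i) -> \sum_(i <- s) a i < 1 ->
  g (x + \sum_(i <- s) a i *: v i) - g x <= \sum_(i <- s) a i * (g (x + v i) - g x).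
Proof.
move=> cg; elim: s a => [|i s IH] a a0; first by rewrite !big_nil addr0 subrr.
rewrite !big_cons => sa1.
have s0 : 0 <= \sum_(j <- s) a j by exact: sumr_ge0.
have b0 : 0 < 1 - a i by lra.
have bN0 : 1 - a i != 0 by rewrite gt_eqF.
pose a' j := a j / (1 - a i).
have a'E : \sum_(j <- s) a' j = (\sum_(j <- s) a j) / (1 - a i) by rewrite mulr_suml.
have a'1 : \sum_(j <- s) a' j < 1 by rewrite a'E ltr_pdivrMr //; lra.
have a'0 j : 0 <= a' j by rewrite divr_ge0 // ltW.
have /= {}IH := IH a' a'0 a'1.
set y := x + \sum_(j <- s) a' j *: v j in IH.
(* y is what remains without v i, rescaled to total weight one (that of x
   included), so that the full combination lies between y and x + v i. *)
have yE : \sum_(j <- s) a j *: v j = (1 - a i) *: (y - x).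
  rewrite /y addrAC subrr add0r scaler_sumr; apply: eq_bigr => j _.
  by rewrite scalerA /a' mulrC divfK.
have -> : x + (a i *: v i + \sum_(j <- s) a j *: v j) = y + a i *: ((x + v i) - y).
  rewrite yE scalerBl scale1r [x + v i]addrC -(addrA (v i)) -(opprB y x).
  by rewrite [in RHS]scalerBr [LHS]addrC -addrA addrAC subrK addrCA.
have a1 : 0 <= a i <= 1 by rewrite a0 /=; lra.
have h := cg y (x + v i) _ a1.
have -> : \sum_(j <- s) a j * (g (x + v j) - g x) =
    (1 - a i) * \sum_(j <- s) a' j * (g (x + v j) - g x).
  by rewrite mulr_sumr; apply: eq_bigr => j _; rewrite /a'; field.
nra.
Qed.

(** * Finite convex functions on column vectors *)

Definition l1 (R : realType) (n : nat) (h : 'cV[R]_n) : R := \sum_i `|h i 0|.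

Lemma l1_ge0 (R : realType) (n : nat) (h : 'cV[R]_n) : 0 <= l1 h.
Proof. exact: sumr_ge0. Qed.

Lemma l1Z (R : realType) (n : nat) (a : R) (h : 'cV[R]_n) : l1 (a *: h) = `|a| * l1 h.
Proof. by rewrite mulr_sumr; apply: eq_bigr => i _; rewrite mxE normrM. Qed.

Lemma l1N (R : realType) (n : nat) (h : 'cV[R]_n) : l1 (- h) = l1 h.
Proof. by apply: eq_bigr => i _; rewrite mxE normrN. Qed.

(** A small displacement is a convex combination of 0 and of the signed basis
    vectors, with weights given by its coordinates. Jensen's inequality bounds g
    above by its values at the finitely many points x + e_i and x - e_i, and
    the bound below follows by reflection through x. *)
Lemma chord_convex_local_lipschitz (R : realType) (n : nat) (g : 'cV[R]_n -> R) (x : 'cV[R]_n) :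
  chord_convex g ->
  exists2 C : R, 0 <= C & forall h, l1 h < 1 -> `|g (x + h) - g x| <= C * l1 h.
Proof.
move=> cg.
pose e (i : 'I_n) : 'cV[R]_n := delta_mx i 0.
pose C := \sum_i (`|g (x + e i) - g x| + `|g (x - e i) - g x|).
have C0 : 0 <= C by apply: sumr_ge0 => i _; rewrite addr_ge0.
exists C => //.
have upper h : l1 h < 1 -> g (x + h) - g x <= C * l1 h.
  move=> h1.
  pose v i := Num.sg (h i 0) *: e i.
  have hE : h = \sum_i `|h i 0| *: v i.
    apply/matrixP => k j; rewrite ord1 summxE (bigD1 k) //= big1 => [|i ik].
      by rewrite !mxE !eqxx mulr1 addr0 mulrC -numEsg.
    by rewrite !mxE eq_sym (negbTE ik) /= !mulr0.
  rewrite {1}hE; apply: le_trans (chord_convex_sum _ _ cg _ h1) _ => //.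
  rewrite mulr_sumr; apply: ler_sum => i _; rewrite mulrC ler_wpM2r //.
  apply: (@le_trans _ _ (`|g (x + e i) - g x| + `|g (x - e i) - g x|)).
    rewrite /v; case: sgrP => _; rewrite ?scale0r ?scale1r ?scaleN1r.
    - by rewrite addr0 subrr addr_ge0.
    - by rewrite (le_trans (ler_norm _)) // lerDl.
    - by rewrite (le_trans (ler_norm _)) // lerDr.
  by rewrite /C (bigD1 i) //= lerDl; apply: sumr_ge0 => j _; rewrite addr_ge0.
move=> h h1; rewrite ler_norml upper // andbT.
have := upper (- h); rewrite l1N => /(_ h1).
have half : 0 <= (2^-1 : R) <= 1 by apply/andP; split; lra.
have := cg (x + h) (x - h) _ half.
have -> : x + h + 2^-1 *: (x - h - (x + h)) = x.
  by apply/matrixP => i j; rewrite !mxE; lra.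
lra.
Qed.

(** The local lower bound extends to all displacements, because the slopes of a
    convex function along a ray from x are nondecreasing. *)
Lemma chord_convex_ge_affine_l1 (R : realType) (n : nat) (g : 'cV[R]_n -> R) (x : 'cV[R]_n) :
  chord_convex g ->
  exists2 C : R, 0 <= C & forall h, g x - C * l1 h <= g (x + h).
Proof.
move=> cg; have [C C0 near] := chord_convex_local_lipschitz x cg.
exists C => // h.
have l0 := l1_ge0 h.
pose t := (1 + l1 h)^-1.
have t0 : 0 < t by rewrite invr_gt0; lra.
have tE : t * (1 + l1 h) = 1 by rewrite mulVf // gt_eqF //; lra.
have t1 : t <= 1 by nra.
have := cg x (x + h) t; rewrite (ltW t0) t1 addrAC subrr add0r => /(_ isT) up.
have := near (t *: h); rewrite l1Z gtr0_norm //.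
have tl : t * l1 h < 1 by nra.
move=> /(_ tl); rewrite ler_norml => /andP[lo _].
rewrite -(ler_pM2l t0); nra.
Qed.

Lemma chord_convex_continuous (R : realType) (n : nat) (g : 'cV[R]_n -> R) :
  chord_convex g -> continuous g.
Proof.
move=> cg x; have [C C0 near] := chord_convex_local_lipschitz x cg.
apply/(@cvgrPdist_le _ _ _ (nbhs x) (nbhs_filter x)) => eps eps0.
(* Coordinatewise distances below d give an l1 distance below n d, which is
   below the minimum even when n is zero. *)
pose d := Num.min 1 (eps / (C + 1)) / (n%:R + 1).
have n0 : 0 <= n%:R :> R by [].
have m0 : 0 < Num.min 1 (eps / (C + 1)).
  by rewrite lt_min ltr01 /= divr_gt0 //; lra.
have d0 : 0 < d by rewrite divr_gt0 //; lra.
apply/nbhs_ballP; exists d => //= y [_ xy].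
have lh : l1 (y - x) <= n%:R * d.
  rewrite -[n in n%:R]card_ord -sum1_card natr_sum mulr_suml.
  apply: ler_sum => i _; rewrite mul1r !mxE -normrN opprB; exact/ltW/xy.
have : l1 (y - x) < Num.min 1 (eps / (C + 1)).
  apply: le_lt_trans lh _; rewrite /d mulrA ltr_pdivrMr; last lra.
  by rewrite mulrC ltr_pM2l //; lra.
rewrite lt_min => /andP[h1]; rewrite ltr_pdivlMr; last lra.
move=> h2; have := near _ h1; rewrite [x + _]addrC subrK distrC => /le_trans; apply.
have := l1_ge0 (y - x); nra.
Qed.

Lemma trmx_continuous (T : topologicalType) (m n : nat) :
  continuous (@trmx T m n).
Proof.
move=> A S [P hP sPS]; exists (fun i j => P j i) => [i j|B PB] /=.
  by have := hP j i; rewrite mxE.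
by apply: sPS => i j; rewrite mxE; apply: PB.
Qed.

(** Carried over by transposition from row vectors, for which compactness of
    boxes is the finite Tychonoff theorem. *)
Lemma box_compact (R : realType) (n : nat) (B : R) :
  compact [set h : 'cV[R]_n | forall i, `|h i 0| <= B].
Proof.
have := @rV_compact R n (fun=> `[- B, B]%classic) (fun _ => @segment_compact _ _ _).
move=> /(continuous_compact (f := @trmx R 1 n)).
have -> : [set h : 'cV[R]_n | forall i, `|h i 0| <= B] =
    @trmx R 1 n @` [set v : 'rV[R]_n | forall i, `[- B, B]%classic (v ord0 i)].
  apply/seteqP; split => [h hB|_ [v vB <-] i] /=.
    exists h^T; last by rewrite trmxK.
    by move=> i /=; rewrite mxE in_itv /= -ler_norml.
  by rewrite mxE ler_norml; have := vB i; rewrite /= in_itv.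
apply; exact/continuous_subspaceT/trmx_continuous.
Qed.

Lemma chord_convex_coercive_minimizer (R : realType) (n : nat) (g : 'cV[R]_n -> R)
    (c : 'cV[R]_n) (B : R) :
  chord_convex g -> 0 <= B ->
  (forall (h : 'cV[R]_n) i, B <= `|h i 0| -> g c <= g (c + h)) ->
  exists z, is_minimizer g z.
Proof.
move=> cg B0 out.
pose A := [set h : 'cV[R]_n | forall i, `|h i 0| <= B].
have A0 : A 0 by move=> i; rewrite mxE normr0.
have [|h _ hmin] := @compact_EVT_min _ R (fun h => g (c + h)) A (ex_intro _ _ A0) (@box_compact R n B).
  exact/continuous_subspaceT/chord_convex_continuous/chord_convex_translate.
exists (c + h) => y; rewrite -(subrK c y) [_ + c]addrC.
have [yA|/existsNP[i /negP]] := pselect (A (y - c)); first exact/hmin/mem_set.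
rewrite -ltNge => /ltW /out; apply: le_trans.
by have := hmin 0 (mem_set A0); rewrite addr0.
Qed.

Local Notation "u ⋅ z" := ((u *m z) 0 0) (at level 40).

(** * Euclidean norm and inner product *)

Lemma enorm_col_sqr (R : realType) (n : nat) (z : 'cV[R]_n) :
  enorm z ^+ 2 = \sum_i z i 0 ^+ 2.
Proof.
rewrite sqr_sqrtr; last by apply: sumr_ge0 => i _; apply: sumr_ge0 => j _; exact: sqr_ge0.
by apply: eq_bigr => i _; rewrite big_ord1.
Qed.

Lemma enorm_row_sqr (R : realType) (n : nat) (u : 'rV[R]_n) :
  enorm u ^+ 2 = \sum_i u 0 i ^+ 2.
Proof.
rewrite sqr_sqrtr; first by rewrite big_ord1.
by apply: sumr_ge0 => i _; apply: sumr_ge0 => j _; exact: sqr_ge0.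
Qed.

Lemma enormZ_sqr (R : realType) (n : nat) (a : R) (z : 'cV[R]_n) :
  enorm (a *: z) ^+ 2 = a ^+ 2 * enorm z ^+ 2.
Proof.
by rewrite !enorm_col_sqr mulr_sumr; apply: eq_bigr => i _; rewrite mxE exprMn.
Qed.

Lemma enormN_sqr (R : realType) (n : nat) (z : 'cV[R]_n) : enorm (- z) ^+ 2 = enorm z ^+ 2.
Proof. by rewrite -scaleN1r enormZ_sqr sqrrN expr1n mul1r. Qed.

(** Summing u_i d_i <= (u_i^2 / L + L d_i^2) / 2 gives the only consequence of the
    Cauchy-Schwarz inequality that is used below. *)
Lemma mulmx_le_of_enorm_le (R : realType) (n : nat) (u : 'rV[R]_n) (d : 'cV[R]_n) (L : R) :
  0 < L -> enorm u <= L * enorm d -> u ⋅ d <= L * enorm d ^+ 2.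
Proof.
move=> L0 ud.
have : enorm u ^+ 2 <= L ^+ 2 * enorm d ^+ 2.
  by rewrite -exprMn lerXn2r // nnegrE ?sqrtr_ge0 // mulr_ge0 ?sqrtr_ge0 // ltW.
rewrite enorm_row_sqr enorm_col_sqr => ud2.
have : 2 * L * (u ⋅ d) <= \sum_i u 0 i ^+ 2 + L ^+ 2 * \sum_i d i 0 ^+ 2.
  rewrite mxE !mulr_sumr -big_split /=; apply: ler_sum => i _.
  have := sqr_ge0 (u 0 i - L * d i 0); nra.
move=> h; rewrite -(ler_pM2l L0); nra.
Qed.

Lemma chord_convex_linear (R : realType) (n : nat) (u : 'rV[R]_n) :
  chord_convex (fun z : 'cV[R]_n => u ⋅ z).
Proof.
move=> x y t _; rewrite mulmxDr -scalemxAr mulmxBr !mxE.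
by rewrite lexx.
Qed.

Lemma chord_convex_sqdist (R : realType) (n : nat) (a : R) (c : 'cV[R]_n) :
  0 <= a -> chord_convex (fun z => a * enorm (z - c) ^+ 2).
Proof.
move=> a0 x y t /andP[t0 t1]; rewrite !enorm_col_sqr.
rewrite -mulrBr mulrCA -mulrDr ler_wpM2l // -sumrB mulr_sumr -big_split /=.
apply: ler_sum => i _; rewrite !mxE.
have : 0 <= t * (1 - t) * (y i 0 - x i 0) ^+ 2.
  by rewrite mulr_ge0 ?sqr_ge0 // mulr_ge0 // subr_ge0.
nra.
Qed.

(** * The proximal model *)

Lemma model_chord_convex (R : realType) (n : nat) (f psi : 'cV[R]_n -> R)
    (a : R) (x : 'cV[R]_n) :
  chord_convex psi -> 0 <= a -> chord_convex (model f psi a x).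
Proof.
move=> cpsi a0; apply: chord_convexD => //; apply: chord_convexD.
  exact: chord_convex_linear.
exact: chord_convex_sqdist.
Qed.

(** The convex part of the model decreases at most linearly in the l1 norm,
    while the proximal term grows quadratically in every coordinate. *)
Lemma model_minimizer_exists (R : realType) (n : nat) (f psi : 'cV[R]_n -> R)
    (a : R) (x : 'cV[R]_n) :
  chord_convex psi -> 0 < a -> exists z, is_minimizer (model f psi a x) z.
Proof.
move=> cpsi a0.
pose u z := (gradient f x) ⋅ z + psi z.
have cu : chord_convex u by apply: chord_convexD => //; exact: chord_convex_linear.
have [C C0 ulo] := chord_convex_ge_affine_l1 x cu.
have n0 : 0 <= n%:R :> R by [].
have cm := model_chord_convex f x cpsi (ltW a0).
have B0 : 0 <= (n%:R + 1) * C / a by rewrite divr_ge0 // ?(ltW a0) // mulr_ge0 //; lra.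
apply: (chord_convex_coercive_minimizer (c := x) cm B0) => h i hi.
have -> : model f psi a x x = u x.
  by rewrite /model /u subrr -(scale0r 0) enormZ_sqr; ring.
have -> : model f psi a x (x + h) = u (x + h) + a * enorm h ^+ 2.
  by rewrite /model /u [x + h]addrC addrK; ring.
suff : C * l1 h <= a * enorm h ^+ 2 by have := ulo h; lra.
rewrite -(ler_pM2l a0) enorm_col_sqr.
move: hi; rewrite ler_pdivrMr // => hi.
(* Every coordinate loses at most C^2 / (2 a) to the linear term after keeping
   half of its quadratic term; the large coordinate i pays for all of them. *)
have hk k : a * (C * `|h k 0|) <= a * (a * h k 0 ^+ 2) / 2 + C ^+ 2 / 2.
  rewrite -(real_normK (num_real (h k 0))); have := sqr_ge0 (a * `|h k 0| - C); nra.
have big_i : n%:R * C ^+ 2 <= a * (a * h i 0 ^+ 2).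
  rewrite -(real_normK (num_real (h i 0))).
  have : ((n%:R + 1) * C) ^+ 2 <= (`|h i 0| * a) ^+ 2.
    by rewrite lerXn2r // nnegrE mulr_ge0 // ?(ltW a0) //; lra.
  have C2 := sqr_ge0 C; have nC := mulr_ge0 n0 C2; have := mulr_ge0 n0 nC; nra.
have sum_i : a * (a * h i 0 ^+ 2) <= a * (a * \sum_k h k 0 ^+ 2).
  rewrite !ler_pM2l // (bigD1 i) //= lerDl; apply: sumr_ge0 => k _; exact: sqr_ge0.
have : a * (C * l1 h) <= a * (a * \sum_k h k 0 ^+ 2) / 2 + n%:R * C ^+ 2 / 2.
  rewrite /l1 !mulr_sumr mulr_suml.
  have -> : n%:R * C ^+ 2 / 2 = \sum_(k < n) C ^+ 2 / 2.
    by rewrite sumr_const card_ord -[RHS]mulr_natl mulrA.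
  by rewrite -big_split /=; apply: ler_sum => k _; exact: hk.
lra.
Qed.

(** The difference quotients of a convex function along the segment to y are at
    most f y - f x for parameters in (0, 1], hence so is their limit. *)
Lemma gradient_inequality (R : realType) (n : nat) (f : 'cV[R]_n -> R) (x y : 'cV[R]_n) :
  chord_convex f -> differentiable f x -> f x + gradient f x ⋅ (y - x) <= f y.
Proof.
move=> cf df.
have -> : gradient f x ⋅ (y - x) = 'D_(y - x) f x.
  rewrite deriveE // mxE.
  have {2}-> : y - x = \sum_i (y - x) i 0 *: (delta_mx i 0 : 'cV[R]_n).
    apply/matrixP => k j; rewrite ord1 summxE (bigD1 k) //= big1 => [|i ik].
      by rewrite !mxE !eqxx mulr1 addr0.
    by rewrite !mxE eq_sym (negbTE ik) /= !mulr0.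
  rewrite linear_sum; apply: eq_bigr => i _.
  by rewrite linearZ mxE deriveE //= mulrC.
suff : 'D_(y - x) f x <= f y - f x by lra.
have dv : derivable f x (y - x) by exact: diff_derivable.
have right : (fun h : R => h^-1 *: ((f \o shift x) (h *: (y - x)) - f x)) @ 0^'+ -->
    'D_(y - x) f x.
  apply: cvg_trans dv; apply: cvg_app => A [e e0 Ae].
  by exists e => // h he h0; apply: Ae he _; exact: lt0r_neq0.
apply: (cvgr_to_le right); near=> h.
have h0 : 0 < h by [].
have h1 : h <= 1 by near: h; exact: nbhs_right_le.
have h01 : 0 <= h <= 1 by rewrite (ltW h0).
have := cf x y h h01; rewrite /= /shift addrC => ch.
rewrite -(ler_pM2l h0) /GRing.scale /= mulrA mulfV ?gt_eqF // mul1r; lra.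
Unshelve. all: by end_near. Qed.

(** Convexity replaces the integral form of the remainder: the gradient
    inequality is used at y, and the gradient is then moved to x. Only the two
    endpoints have to satisfy the Lipschitz estimate, at the cost of L in place
    of L/2. *)
Lemma convex_descent (R : realType) (n : nat) (f : 'cV[R]_n -> R) (x y : 'cV[R]_n) (L : R) :
  chord_convex f -> differentiable f y -> 0 < L ->
  enorm (gradient f y - gradient f x) <= L * enorm (y - x) ->
  f y <= f x + gradient f x ⋅ (y - x) + L * enorm (y - x) ^+ 2.
Proof.
move=> cf df L0 /(mulmx_le_of_enorm_le L0).
have := gradient_inequality x cf df.
have -> : (gradient f y - gradient f x) ⋅ (y - x) =
    - (gradient f y ⋅ (x - y)) - gradient f x ⋅ (y - x).
  rewrite !mxE -sumrN -sumrB; apply: eq_bigr => j _; rewrite !mxE; ring.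
lra.
Qed.

Lemma model_center (R : realType) (n : nat) (f psi : 'cV[R]_n -> R) (a : R) (x : 'cV[R]_n) :
  model f psi a x x = gradient f x ⋅ x + psi x.
Proof. by rewrite /model subrr -(scale0r 0) enormZ_sqr expr0n mul0r mulr0 addr0. Qed.

Lemma objective_le_model (R : realType) (n : nat) (f psi : 'cV[R]_n -> R)
    (x y : 'cV[R]_n) (L a : R) :
  chord_convex f -> differentiable f y -> 0 < L ->
  enorm (gradient f y - gradient f x) <= L * enorm (y - x) ->
  f y + psi y <= f x + psi x + (model f psi a x y - model f psi a x x)
                 + (L - a) * enorm (y - x) ^+ 2.
Proof.
move=> cf df L0 lip; have := convex_descent cf df L0 lip.
rewrite model_center /model.
have -> : gradient f x ⋅ (y - x) = gradient f x ⋅ y - gradient f x ⋅ x.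
  by rewrite mulmxBr mxE; congr (_ + _); rewrite mxE.
lra.
Qed.

(** Let s be the largest parameter in [0, 1] for which x + s (z - x) is in K. By
    the decrease of phi along the segment this point is in the level set, hence
    interior to K, which contradicts the choice of s unless s = 1. *)
Lemma minimizer_in_compact (R : realType) (n : nat) (f psi : 'cV[R]_n -> R)
    (x z : 'cV[R]_n) (K : set 'cV[R]_n) (L a v : R) :
  chord_convex f -> (forall y, differentiable f y) -> chord_convex psi ->
  compact K -> [set y | f y + psi y <= v] `<=` K° ->
  0 < L -> (forall x y, K x -> K y ->
    enorm (gradient f x - gradient f y) <= L * enorm (x - y)) ->
  f x + psi x <= v -> L <= a -> is_minimizer (model f psi a x) z ->
  K z.
Proof.
move=> cf df cpsi Kc lev L0 lip xv La zmin.
have Kx : K x by apply: interior_subset; exact: lev.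
pose p (t : R) := x + t *: (z - x).
have pc : continuous p.
  by move=> t; apply: cvgD; [exact: cvg_cst|apply: cvgZr_tmp; exact: cvg_id].
have Kp t : 0 <= t <= 1 -> K (p t) -> K° (p t).
  move=> t01 Kpt; apply: lev; apply: le_trans xv.
  have a0 : 0 <= a by lra.
  have := model_chord_convex f x cpsi a0 x z t01; rewrite -/(p t).
  have := objective_le_model psi a cf (df (p t)) L0 (lip _ _ Kpt Kx).
  have := zmin x; have := sqr_ge0 (enorm (p t - x)).
  by case/andP: t01; nra.
pose S := [set t : R | 0 <= t <= 1 /\ K (p t)].
have S0 : S 0 by split; rewrite ?lexx ?ler01 // /p scale0r addr0.
have Sc : compact S.
  have -> : S = `[0, 1]%classic `&` p @^-1` K.
    by apply/seteqP; split => t /=; rewrite in_itv.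
  apply: compact_closedI; first exact: segment_compact.
  apply: closed_comp; first by move=> t _; exact: pc.
  exact: compact_closed (@norm_hausdorff _ _) Kc.
have [|s /set_mem[s01 Ks] smax] := @compact_EVT_max _ R id S (ex_intro _ _ S0) Sc.
  by apply: continuous_subspaceT => t; exact: cvg_id.
have [s1|s1] := eqVneq s 1; first by move: Ks; rewrite s1 /p scale1r addrC subrK.
have slt : s < 1 by rewrite lt_neqAle s1; case/andP: s01.
have : \forall t \near s^'+, K (p t).
  apply: cvg_at_right_filter (pc s) _ (Kp s s01 Ks).
move=> near_s.
have [t [Kt [st t1]]] : exists t, K (p t) /\ s < t /\ t <= 1.
  near s^'+ => t; exists t; split; first by near: t.
  by split; near: t; [exact: nbhs_right_gt|exact: nbhs_right_le].
have : t <= s by apply/smax/mem_set; split => //; case/andP: s01 => *; apply/andP; split; lra.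
lra.
Unshelve. all: by end_near. Qed.

(** * Line search *)

Lemma accepted_of_large_stepsize (R : realType) (n : nat) (f psi : 'cV[R]_n -> R)
    (x : 'cV[R]_n) (K : set 'cV[R]_n) (L sigma a v ref : R) :
  chord_convex f -> (forall y, differentiable f y) -> chord_convex psi ->
  compact K -> [set y | f y + psi y <= v] `<=` K° ->
  0 < L -> (forall x y, K x -> K y ->
    enorm (gradient f x - gradient f y) <= L * enorm (x - y)) ->
  f x + psi x <= v -> f x + psi x <= ref ->
  0 < sigma < 1 -> L <= (1 - sigma) * a ->
  exists z, accepted f psi sigma ref a x z.
Proof.
move=> cf df cpsi Kc lev L0 lip xv xref /andP[s0 s1] La.
have a0 : 0 < a.
  by rewrite -(@pmulr_rgt0 _ (1 - sigma)) ?(lt_le_trans L0 La) ?subr_gt0.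
have [z zmin] := model_minimizer_exists f x cpsi a0.
have La' : L <= a by have := mulr_gt0 s0 a0; lra.
have Kz := minimizer_in_compact cf df cpsi Kc lev L0 lip xv La' zmin.
have Kx : K x by apply: interior_subset; exact: lev.
exists z; split=> //.
have := objective_le_model psi a cf (df z) L0 (lip _ _ Kz Kx).
have := zmin x; have := sqr_ge0 (enorm (z - x)); nra.
Qed.

(** If the accepted alpha is not the first trial value, then alpha / eta was
    rejected and is below the threshold b. *)
Lemma accepted_stepsize_bounds (R : realType) (n : nat) (f psi : 'cV[R]_n -> R)
    (eta sigma amin amax ref b : R) (x z : 'cV[R]_n) :
  1 < eta -> 0 < amin -> 0 <= b ->
  (forall a, b <= a -> exists y, accepted f psi sigma ref a x y) ->
  sparsa_step f psi eta sigma amin amax ref x z ->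
  exists a, [/\ amin <= a, a <= amax + eta * b & accepted f psi sigma ref a x z].
Proof.
move=> eta1 amin0 b0 large [a0 [j [/andP[lo hi] acc rej]]].
have pow1 i : 1 <= eta ^+ i by rewrite exprn_ege1 // ltW.
have a0_gt0 : 0 < a0 by lra.
have etab : 0 <= eta * b by rewrite mulr_ge0 //; lra.
exists (eta ^+ j * a0); split=> //; first by apply: le_trans lo _; rewrite ler_peMl // ltW.
case: j => [|j] in acc rej *; first by rewrite expr0 mul1r; lra.
have [/large[y accy]|lt_b] := leP b (eta ^+ j * a0); first by case: (rej j y).
rewrite exprS -mulrA; nra.
Qed.

(** * Linear convergence *)

(** The comparison point x + t (xstar - x), with t = mu / (2 abar + mu), balances
    the gain t e against the proximal cost abar t^2 |x - xstar|^2 <= (t / 2) e.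
    The leftover L |z - x|^2 is at most q (ref - phi z) by the acceptance test,
    and moving q phi z to the left yields the factor
    (1 - t/2 + q) / (1 + q) < 1. *)
Lemma accepted_contraction (R : realType) (n : nat) (f psi phi : 'cV[R]_n -> R)
    (xstar : 'cV[R]_n) (K : set 'cV[R]_n) (L sigma amin abar mu : R) :
  (forall y, phi y = f y + psi y) ->
  chord_convex f -> (forall y, differentiable f y) -> chord_convex psi ->
  0 < L -> (forall x y, K x -> K y ->
    enorm (gradient f x - gradient f y) <= L * enorm (x - y)) ->
  0 < sigma -> 0 < amin -> amin <= abar -> 0 < mu ->
  (forall y, phi xstar + mu * enorm (y - xstar) ^+ 2 <= phi y) ->
  exists2 kappa, 0 < kappa < 1 &
    forall x z a ref, K x -> K z -> amin <= a <= abar -> phi x <= ref ->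
      accepted f psi sigma ref a x z ->
      phi z - phi xstar <= kappa * (ref - phi xstar).
Proof.
move=> hphi cf df cpsi L0 lip s0 amin0 loabar mu0 growth.
pose q := L / (sigma * amin); pose t := mu / (2 * abar + mu).
have ab0 : 0 < 2 * abar + mu by lra.
have t0 : 0 < t by rewrite divr_gt0.
have tE : t * (2 * abar + mu) = mu by rewrite divfK // gt_eqF.
have t1 : t <= 1 by rewrite ler_pdivrMr //; lra.
have t01 : 0 <= t <= 1 by rewrite (ltW t0).
have qE : q * (sigma * amin) = L by rewrite divfK // gt_eqF // mulr_gt0.
have q0 : 0 < q by rewrite divr_gt0 // mulr_gt0.
exists ((1 - t / 2 + q) / (1 + q)).
  by rewrite divr_gt0 ?ltr_pdivrMr /=; lra.
move=> x z a ref Kx Kz /andP[lo hi] xref [zmin dec].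
rewrite mulrAC ler_pdivlMr; last lra.
rewrite mulrC.
set e := phi x - phi xstar.
set D := enorm (z - x) ^+ 2.
set r := enorm (x - xstar) ^+ 2.
have growth_x : phi xstar + mu * r <= phi x := growth x.
have D0 : 0 <= D by exact: sqr_ge0.
have r0 : 0 <= r by exact: sqr_ge0.
have step : phi z <= phi x - t * e + a * t ^+ 2 * r + L * D.
  have := objective_le_model psi a cf (df z) L0 (lip _ _ Kz Kx); rewrite -!hphi -/D.
  have := zmin (x + t *: (xstar - x)); rewrite model_center.
  rewrite {2}/model [x + _]addrC addrK enormZ_sqr.
  rewrite -(opprB x xstar) enormN_sqr -/r opprB [_ + x]addrC.
  have := cpsi x xstar t t01.
  have := chord_convex_linear (gradient f x) x xstar t01.
  have := gradient_inequality xstar cf (df x).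
  have -> : gradient f x ⋅ (xstar - x) = gradient f x ⋅ xstar - gradient f x ⋅ x.
    by rewrite mulmxBr mxE; congr (_ + _); rewrite mxE.
  move: (hphi x) (hphi xstar); rewrite /e.
  move: (gradient f x ⋅ xstar) (gradient f x ⋅ x) (gradient f x ⋅ _) => A B C.
  nra.
have e0 : 0 <= e by rewrite /e; nra.
have tr : a * t ^+ 2 * r <= t / 2 * e.
  have at_mu : a * t <= mu / 2 by have := ler_wpM2r (ltW t0) hi; have := mulr_gt0 t0 mu0; lra.
  have atr : a * t * r <= e / 2.
    by apply: le_trans (ler_wpM2r r0 at_mu) _; rewrite /e; lra.
  by have := ler_wpM2l (ltW t0) atr; lra.
have LD : L * D <= q * (ref - phi z).
  have : sigma * amin * D <= ref - phi z.
    have := ler_wpM2r D0 (ler_wpM2l (ltW s0) lo); rewrite -/D in dec; rewrite hphi; lra.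
  by move=> sD; rewrite -qE -mulrA ler_pM2l.
have : (1 - t / 2) * e <= (1 - t / 2) * (ref - phi xstar).
  by rewrite ler_wpM2l /e; lra.
rewrite /e in step tr *; lra.
Qed.

Lemma bernoulli (R : realType) (d : R) (m : nat) :
  0 <= d <= 1 -> 1 - d * m%:R <= (1 - d) ^+ m.
Proof.
move=> /andP[d0 d1]; elim: m => [|m IH]; first by rewrite mulr0 subr0.
rewrite exprS -addn1 natrD.
have omd0 : 0 <= 1 - d by rewrite subr_ge0.
have := ler_wpM2l omd0 IH.
have : 0 <= m%:R * d ^+ 2 by rewrite mulr_ge0 ?sqr_ge0.
nra.
Qed.

(** By Bernoulli's inequality theta = 1 - (1 - kappa) / M will do. *)
Lemma exists_power_ge (R : realType) (M : nat) (kappa : R) :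
  (0 < M)%N -> 0 < kappa < 1 ->
  exists2 theta : R, 0 < theta < 1 & kappa <= theta ^+ M.
Proof.
move=> M0 /andP[k0 k1].
have M1 : 1 <= M%:R :> R by rewrite ler1n.
pose d := (1 - kappa) / M%:R.
have dE : d * M%:R = 1 - kappa by rewrite divfK // gt_eqF //; lra.
have d0 : 0 < d by rewrite divr_gt0 //; lra.
have d1 : d <= 1 - kappa by rewrite -dE ler_peMr // ltW.
exists (1 - d); first by apply/andP; split; lra.
have d01 : 0 <= d <= 1 by apply/andP; split; lra.
by have := bernoulli M d01; rewrite dE; lra.
Qed.

(** The oldest error in a window of length M dominates the geometric bound, and
    it is at most M steps behind the new one: this costs exactly the factor
    theta^M. *)
Lemma windowed_contraction (R : realType) (M N : nat) (theta : R) (e : nat -> R) :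
  0 < theta < 1 -> 0 <= e 1%N ->
  (forall k, (0 < k < N)%N ->
    exists2 j, (j < minn k M)%N & e k.+1 <= theta ^+ M * e (k - j)%N) ->
  forall k, (0 < k <= N)%N -> e k <= theta^-1 * theta ^+ k * e 1%N.
Proof.
move=> /andP[t0 t1] e1 rec k; have [m] := ubnP k.
elim: m k => // m IH [|[|k]] // km kN; first by rewrite expr1 mulVf ?gt_eqF // mul1r.
have [j] := rec k.+1 ltac:(lia); rewrite leq_min => /andP[jk jM] h.
have := IH (k.+1 - j)%N ltac:(lia) ltac:(lia) => IHj.
apply: le_trans h _.
apply: le_trans (ler_wpM2l (exprn_ge0 _ (ltW t0)) IHj) _.
have pw : theta ^+ M * theta ^+ (k.+1 - j) <= theta ^+ k.+2.
  by rewrite -exprD ler_wiXn2l ?(ltW t0) ?(ltW t1) //; lia.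
rewrite mulrA [theta ^+ M * _]mulrCA ler_wpM2r // ler_wpM2l // invr_ge0.
exact: ltW.
Qed.

(** * The GLL reference value *)

Lemma gll_reference_attained (R : realType) (n : nat) (phi : 'cV[R]_n -> R)
    (M : nat) (x : nat -> 'cV[R]_n) (k : nat) :
  (0 < k)%N -> (0 < M)%N ->
  exists2 j, (j < minn k M)%N & gll_reference phi M x k = phi (x (k - j)%N).
Proof.
move=> k0 M0; rewrite /gll_reference big_mkord.
have h0 : (0 < minn k M)%N by rewrite leq_min k0.
elim/big_rec: _ => [|i v _ [j jk ->]]; first by exists 0%N; rewrite ?subn0.
by case: (leP (phi (x (k - i)%N)) (phi (x (k - j)%N))) => _; [exists j|exists i].
Qed.

Lemma gll_reference_ge (R : realType) (n : nat) (phi : 'cV[R]_n -> R)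
    (M : nat) (x : nat -> 'cV[R]_n) (k : nat) :
  phi (x k) <= gll_reference phi M x k.
Proof. exact: bigmax_ge_id. Qed.

Theorem theorem4p1 (R : realType) (n : nat) (f psi phi : 'cV[R]_n -> R)
    (hphi : forall z, phi z = f z + psi z)
    (f_smooth : smooth f)
    (eta sigma amin amax : R)
    (heta : 1 < eta) (hsigma : 0 < sigma < 1)
    (hamin : 0 < amin) (hamax : amin <= amax)
    (phiR : nat -> R) (x : nat -> 'cV[R]_n)
    (hx : sparsa f psi eta sigma amin amax phiR x)
    (K : set 'cV[R]_n) (K_compact : compact K) (K_convex : convex_set K)
    (level_sub : [set z | phi z <= phi (x 1%N)] `<=` K°)
    (f_lip : lipschitz_gradient_on K f)
    (psi_convex : convex_function setT psi)
    (xstar : 'cV[R]_n) (hxstar : is_minimizer phi xstar)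
    (f_convex : convex_function setT f)
    (mu : R) (hmu : 0 < mu)
    (growth : forall y, phi xstar + mu * enorm (y - xstar) ^+ 2 <= phi y)
    (M : nat) (hM : (1 <= M)%N)
    (hphiR : forall k, generated x k -> phiR k = gll_reference phi M x k) :
  exists theta c : R, 0 < theta < 1 /\
    forall k, generated x k ->
      phi (x k) - phi xstar <= c * theta ^+ k * (phi (x 1%N) - phi xstar).
Proof.
have cf := convex_function_chord f_convex.
have cpsi := convex_function_chord psi_convex.
case: f_smooth => df _.
have [s0 s1] := andP hsigma.
(* The constant of the hypothesis may be nonpositive, for instance when K has at
   most one point; a positive one is needed as a divisor. *)
have [L L0 lip] : exists2 L : R, 0 < L & forall x y, K x -> K y ->
    enorm (gradient f x - gradient f y) <= L * enorm (x - y).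
  have [L0 lip] := f_lip; exists (`|L0| + 1); first by rewrite ltr_wpDl.
  move=> u v Ku Kv; apply: le_trans (lip u v Ku Kv) _.
  by rewrite ler_wpM2r ?sqrtr_ge0 // (le_trans (ler_norm _)) // lerDl.
have in_K y : phi y <= phi (x 1%N) -> K y.
  by move=> y1; apply: interior_subset; exact: level_sub.
pose b := L / (1 - sigma).
have b0 : 0 <= b by rewrite divr_ge0 ?(ltW L0) // subr_ge0 ltW.
pose abar := amax + eta * b.
have loabar : amin <= abar by rewrite (le_trans hamax) // lerDl mulr_ge0 // ltW // (lt_trans ltr01).
have stepsize k : (0 < k)%N -> executed x k -> phi (x k) <= phi (x 1%N) ->
    phi (x k) <= phiR k ->
    exists a, amin <= a <= abar /\ accepted f psi sigma (phiR k) a (x k) (x k.+1).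
  move=> k0 ek lek ref_k.
  have [|a [lo hi acc]] := accepted_stepsize_bounds heta hamin b0 _ (hx k k0 ek).
    move=> a ba; apply: (@accepted_of_large_stepsize _ _ _ _ _ K L _ _ (phi (x 1%N))) => //.
    - by move=> y /=; rewrite -hphi; exact: level_sub.
    - by rewrite -hphi.
    - by rewrite -hphi.
    - by move: ba; rewrite ler_pdivrMr ?subr_gt0 // mulrC.
  by exists a; rewrite lo hi.
have executed_le i k : (i <= k)%N -> executed x k -> executed x i.
  by move=> ik ek j /andP[j0 ji]; apply: ek; rewrite j0 (leq_trans ji).
have reference k : (0 < k)%N -> executed x k -> phi (x k) <= phiR k /\
    exists2 j, (j < minn k M)%N & phiR k = phi (x (k - j)%N).
  move=> k0 ek; rewrite hphiR; last by split=> //; exact: executed_le (leq_pred k) ek.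
  by split; [exact: gll_reference_ge|exact: gll_reference_attained].
(* The reference value is a former objective value, so no iterate leaves the
   level set of the first one. *)
have level k : (0 < k)%N -> executed x k.-1 -> phi (x k) <= phi (x 1%N).
  have [m] := ubnP k; elim: m k => // m IH [|[|k]] //= km _ ek.
  have [ref_ge [j]] := reference k.+1 isT ek; rewrite leq_min => /andP[jk _] refE.
  have [|a [/andP[lo _] [_ dec]]] := stepsize k.+1 isT ek _ ref_ge.
    by apply: IH => //; exact: executed_le ek.
  apply: (@le_trans _ _ (phiR k.+1)).
    rewrite hphi (le_trans dec) // gerBl mulr_ge0 ?sqr_ge0 //.
    by rewrite mulr_ge0 ?(ltW s0) // (le_trans (ltW hamin)).
  rewrite refE; apply: IH; rewrite ?subn_gt0 //.
    exact: leq_ltn_trans (leq_subr j k.+1) km.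
  exact: executed_le (leq_trans (leq_pred _) (leq_subr _ _)) ek.
have [kappa kappa01 contract] :=
  accepted_contraction hphi cf df cpsi L0 lip s0 hamin loabar hmu growth.
have [theta theta01 kappa_le] := exists_power_ge hM kappa01.
(* The iterates are numbered from 1, hence the constant theta^-1. *)
exists theta, theta^-1; split=> // k [k0 ek].
have e0 y : 0 <= phi y - phi xstar by rewrite subr_ge0.
apply: (@windowed_contraction R M k theta (fun i => phi (x i) - phi xstar)) => //; last first.
  by rewrite k0 leqnn.
move=> i /andP[i0 ik].
have ei : executed x i by apply: executed_le ek; rewrite -ltnS prednK.
have ei1 := executed_le _ _ (leq_pred i) ei.
have [ref_ge [j jM refE]] := reference i i0 ei.
have li := level i i0 ei1.
have [a [a_bounds acc]] := stepsize i i0 ei li ref_ge.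
exists j => //; apply: le_trans (contract _ _ _ _ _ _ a_bounds ref_ge acc) _.
- exact: in_K.
- by apply: in_K; exact: level i.+1 isT ei.
- by rewrite refE ler_wpM2r.
Qed.
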